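(* The set $S_0$ is dense in $S$ for the topology of uniform convergence on compact subsets of $\mathbb{R}$.
   Context: $S$ denotes the set of continuous functions $\phi:\mathbb{R}\to\mathbb{C}$ such that $\phi(0)=1$ and $\phi(-\lambda)=\overline{\phi(\lambda)}$ for all $\lambda\in\mathbb{R}$. $S_0$ denotes the set of functions from $\mathbb{R}$ to $\mathbb{C}$ which can be obtained as the characteristic function $\lambda\mapsto\mathbb{E}[e^{i\lambda X}]$ of a real random variable $X$, divided by the characteristic function $\lambda\mapsto e^{im\lambda-\sigma^2\lambda^2/2}$ of a (real) Gaussian random variable with some mean $m$ and variance $\sigma^2$. One has $S_0\subset S$. *)

(* Defs.v *)
From HB Require Import structures.
From mathcomp Require Import all_boot all_order all_algebra.
From mathcomp Require Import complex.
From mathcomp Require Import all_classical all_reals all_analysis.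

Set Implicit Arguments.
Unset Strict Implicit.
Unset Printing Implicit Defensive.

Import Order.TTheory GRing.Theory Num.Theory.
Import numFieldNormedType.Exports.

Local Open Scope classical_set_scope.
Local Open Scope ring_scope.

(* The bare type [R[i]] carries no topology; [R[i]^o] is convertible to it and
   has the topology and uniformity of the modulus. *)

Definition dense_in (T : topologicalType) (A B : set T) : Prop :=
  A `<=` B /\ B `<=` closure A.

Definition cexp (R : realType) (z : R[i]) : R[i] :=
  (expR (complex.Re z))%:C%C * (cos (complex.Im z) +i* sin (complex.Im z))%C.

(* Complex-valued expectation, to be used only when the real and imaginary
   parts of [Z] are integrable ([fine] sends infinite values to 0). *)
Definition cexpectation (d : measure_display) (T : measurableType d)
    (R : realType) (P : probability T R) (Z : T -> R[i]) : R[i] :=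
  (fine 'E_P[fun w => complex.Re (Z w)]%E
   +i* fine 'E_P[fun w => complex.Im (Z w)]%E)%C.

Definition charfun (d : measure_display) (T : measurableType d)
    (R : realType) (P : probability T R) (X : {RV P >-> R}) : R -> R[i]^o :=
  fun lambda => cexpectation P (fun w => cexp ('i%C * (lambda * X w)%:C%C)).

Definition gaussian_charfun (R : realType) (m sigma : R) : R -> R[i]^o :=
  fun lambda =>
    cexp ('i%C * (m * lambda)%:C%C - (sigma ^+ 2 * lambda ^+ 2 / 2)%:C%C).

Definition setS (R : realType) : set (R -> R[i]^o) :=
  [set phi : R -> R[i]^o | [/\ continuous phi, phi 0 = 1 &
    forall lambda : R, phi (- lambda) = (phi lambda)^*%C]].

(* Taking [0 <= sigma] instead gives the same set: multiply numerator and
   denominator by the characteristic function of a standard Gaussian variable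
   independent of [X]. *)
Definition setS0 (R : realType) : set (R -> R[i]^o) :=
  [set phi : R -> R[i]^o | exists (d : measure_display) (T : measurableType d)
      (P : probability T R) (X : {RV P >-> R}) (m sigma : R),
    0 < sigma /\
    forall lambda : R,
      phi lambda = charfun X lambda / gaussian_charfun m sigma lambda].

Arguments setS R : clear implicits.
Arguments setS0 R : clear implicits.

(* Main.v *)
(* If [q = sum_j c_j exp(i l y_j)] is an exponential sum with real coefficients
   whose analytic continuation [sum_j c_j exp(t y_j)] is nonnegative for real
   [t], then
     [sum_j c_j exp(y_j^2 / (2 s^2)) N(y_j, s^2)(x) = N(0, s^2)(x) q(x / s^2)]
   is nonnegative (complete the square); normalized, it is a probability
   density, and its characteristic function divided by that of [N(0, s^2)] is
   [sum_j c_j exp(y_j^2 / (2 s^2)) exp(i l y_j)] up to a constant, which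
   tends to [q] as [s] grows. So it suffices to approximate [phi] on [[-N, N]] by such
   sums. A continuous hermitian function is a uniform limit on [[-N, N]] of
   exponential sums with real coefficients, and nonnegativity is obtained from
   [phi = a^2 + b^2], where [a = (1 + phi) / 2] and
   [b = i sgn(l) (1 - phi) / 2] are continuous and hermitian because
   [phi 0 = 1]: approximate [a] and [b], then square. *)
From HB Require Import structures.
Require Import Defs.
From mathcomp Require Import all_boot all_order all_algebra.
From mathcomp Require Import complex.
From mathcomp Require Import all_classical all_reals all_analysis.
From mathcomp Require Import measurable_realfun ring lra.
Import numFieldNormedType.Exports.

Set Implicit Arguments.
Unset Strict Implicit.
Unset Printing Implicit Defensive.

Import Order.TTheory GRing.Theory Num.Theory.

Local Open Scope classical_set_scope.
Local Open Scope ring_scope.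

Import Normc.
Local Open Scope charge_scope.

(** * Bernstein approximation *)

Section bernstein.
Context {R : realType}.
Implicit Types (x c v : R) (n : nat) (f h : nat -> R).

(* The expectation of [f] at a binomial variable with parameters [n] and [x],
   computed by conditioning on the first trial: the Bernstein polynomial of [g]
   is obtained for [f k = g (k / n)]. *)
Fixpoint bernstein x n f : R :=
  if n is m.+1 then
    (1 - x) * bernstein x m f + x * bernstein x m (fun k => f k.+1)
  else f 0%N.

(** Conditioning on the first trial gives convex combinations with weights [1 - x] and [x], so a
    pointwise bound passes to the expectation by induction. *)
Lemma bernstein_le x n f h v : 0 <= x <= 1 ->
  (forall k, (k <= n)%N -> `|f k - v| <= h k) ->
  `|bernstein x n f - v| <= bernstein x n h.
Proof.
move=> /andP[x0 x1]; elim: n f h => [|n IH] f h fh /=; first exact: fh.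
have H1 := IH f h (fun k kn => fh k (leqW kn)).
have H2 := IH (fun k => f k.+1) (fun k => h k.+1) (fun k kn => fh k.+1 kn).
rewrite (_ : _ - v = (1 - x) * (bernstein x n f - v) +
  x * (bernstein x n (fun k => f k.+1) - v)); last by ring.
rewrite (le_trans (ler_normD _ _))// !normrM (ger0_norm x0).
by rewrite ger0_norm ?subr_ge0// lerD// ler_wpM2l// subr_ge0.
Qed.

(** Mean [n x] and variance [n x (1 - x)] of the binomial law. The shift [c] makes the induction
    work: a first success replaces [c] by [1 + c]. *)
Lemma bernstein_sqr x n (a b c : R) :
  bernstein x n (fun k => a + b * (k%:R + c) ^+ 2) =
  a + b * (n%:R * (x * (1 - x)) + (n%:R * x + c) ^+ 2).
Proof.
elim: n c => [|n IH] c /=; first by ring.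
rewrite IH; under [X in bernstein x n X]eq_fun do rewrite -natr1 -addrA.
by rewrite IH -natr1; ring.
Qed.

(** Heine-Cantor: a radius that works near each point of the segment works on all of it, by the
    covering form of compactness. *)
Lemma continuous_segment_unif (g : R -> R) (a b e : R) :
  continuous g -> 0 < e ->
  exists2 d : R, 0 < d & forall x y, x \in `[a, b] -> `|y - x| < d ->
    `|g y - g x| <= e.
Proof.
move=> cg e0.
have /compact_near_coveringP cab := @segment_compact R a b.
pose P (d x : R) := forall y, `|y - x| < d -> `|g y - g x| <= e.
have : \forall d \near (0:R)^'+, `[a, b] `<=` P d.
  apply: cab => x xab.
  have /cvgrPdist_lt/(_ (e / 2)) := cg x.
  rewrite divr_gt0// => /(_ isT)[d/= d0 gd].
  exists (ball x (d / 2), [set r | r < d / 2]); first split => /=.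
  - by apply: nbhsx_ballx; rewrite divr_gt0.
  - by apply: nbhs_right_lt; rewrite divr_gt0.
  case=> x' r /= []; rewrite /ball/= => xx' rd y yx'.
  have H1 : `|g x - g x'| < e / 2.
    by apply: gd => /=; rewrite (lt_le_trans xx')//; lra.
  have H2 : `|g x - g y| < e / 2.
    apply: gd => /=; rewrite (_ : x - y = (x - x') - (y - x')); last by ring.
    by rewrite (le_lt_trans (ler_normB _ _))//; lra.
  rewrite (_ : g y - g x' = (g x - g x') - (g x - g y)); last by ring.
  by rewrite (le_trans (ler_normB _ _))//; lra.
move=> nearP; near (0:R)^'+ => d.
exists d; first by near: d; exact: nbhs_right_gt.
move=> x y xab; have : `[a, b] `<=` P d by near: d.
by apply; exact: xab.
Unshelve. all: by end_near. Qed.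

Lemma continuous_segment_bounded (g : R -> R) (a b : R) : continuous g ->
  exists2 M : R, 0 <= M & forall x, x \in `[a, b] -> `|g x| <= M.
Proof.
move=> cg.
have /compact_bounded[M [_ gM]] : compact (g @` `[a, b]).
  apply: continuous_compact; last exact: segment_compact.
  exact: continuous_subspaceT.
exists (`|M| + 1); first by rewrite addr_ge0.
move=> x xab; apply: gM; last by exists x.
by rewrite (le_lt_trans (ler_norm _))// ltrDl.
Qed.

(** Chebyshev's argument: near [x] uniform continuity bounds the error by [e / 2]; at distance at
    least [d] the error, at most [2 M], is below [C (y - x)^2]. The variance then contributes at
    most [C / n]. *)
Lemma bernstein_approx (g : R -> R) (e : R) : continuous g -> 0 < e ->
  exists n, forall x, 0 <= x <= 1 ->
    `|bernstein x n (fun k => g (k%:R / n%:R)) - g x| <= e.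
Proof.
move=> cg e0.
have [M M0 gM] := continuous_segment_bounded 0 1 cg.
have e20 : 0 < e / 2 by rewrite divr_gt0.
have [d d0 gd] := continuous_segment_unif 0 1 cg e20.
pose C := 2 * M / d ^+ 2.
have C0 : 0 <= C by rewrite divr_ge0 ?sqr_ge0// mulr_ge0.
pose n := (Num.truncn (C / (e / 2))).+1.
have n0 : 0 < n%:R :> R by rewrite ltr0n.
have Cn : C / n%:R <= e / 2.
  rewrite ler_pdivrMr// mulrC -ler_pdivrMr//.
  by rewrite ltW// truncnS_gt.
exists n => x x01; have [x0 x1] := andP x01.
have Hk k : (k <= n)%N -> `|g (k%:R / n%:R) - g x| <=
    e / 2 + C / n%:R ^+ 2 * (k%:R + - (n%:R * x)) ^+ 2.
  move=> kn; set y := k%:R / n%:R.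
  have y01 : y \in `[0, 1].
    by rewrite in_itv/= /y divr_ge0//= ler_pdivrMr// mul1r ler_nat.
  rewrite (_ : C / n%:R ^+ 2 * _ = C * (y - x) ^+ 2); last first.
    by rewrite /y; field; rewrite gt_eqF.
  have [yx|yx] := ltP `|y - x| d.
    rewrite (le_trans (gd _ _ _ yx)) ?in_itv//= lerDl.
    by rewrite mulr_ge0// sqr_ge0.
  have gx := gM x; have gy := gM y y01.
  have {}gx : `|g x| <= M by apply: gx; rewrite in_itv.
  rewrite (le_trans (ler_normB _ _))//.
  suff : 2 * M <= C * (y - x) ^+ 2 by lra.
  rewrite /C mulrAC -mulrA -[leLHS]mulr1 ler_wpM2l ?mulr_ge0//.
  rewrite ler_pdivlMr ?exprn_gt0// mul1r -[leRHS]real_normK ?num_real//.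
  by rewrite lerXn2r ?nnegrE// ltW.
apply: (le_trans (bernstein_le x01 Hk)).
rewrite bernstein_sqr subrr expr0n/= addr0.
rewrite (_ : _ * (_ * _) = C / n%:R * (x * (1 - x))); last first.
  by field; rewrite gt_eqF.
suff : C / n%:R * (x * (1 - x)) <= C / n%:R by lra.
have : 0 <= C / n%:R by rewrite divr_ge0// ltW.
move: (C / _) => u u0; nra.
Qed.

End bernstein.

(** * The real-valued modulus of complex numbers *)

Section modulus.
Context {R : realType}.
Implicit Types z w : R[i].

(** The norm on [R[i]] takes values in [R[i]]; this passes to the real number [normc], in which the
    estimates are made. *)
Lemma normr_complexE z : `|z| = (normc z)%:C%C.
Proof. by case: z. Qed.

Lemma normc_ge0 z : 0 <= normc z.
Proof. by case: z => a b /=; exact: sqrtr_ge0. Qed.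

Lemma normcD z w : normc (z + w) <= normc z + normc w.
Proof. exact: (@le_normcD R z w). Qed.

Lemma normcN z : normc (- z) = normc z.
Proof. by case: z => a b /=; rewrite !sqrrN. Qed.

Lemma normcB z w : normc (z - w) <= normc z + normc w.
Proof. by rewrite -(normcN w) normcD. Qed.

Lemma normc_conj z : normc z^*%C = normc z.
Proof. by case: z => a b /=; rewrite sqrrN. Qed.

Lemma normc_real (x : R) : normc x%:C%C = `|x|.
Proof. by rewrite /= expr0n/= addr0 sqrtr_sqr. Qed.

Lemma normc_i : normc ('i%C : R[i]) = 1.
Proof. by rewrite /= expr0n/= expr1n add0r sqrtr1. Qed.

Lemma normc_le_ReIm z : normc z <= `|complex.Re z| + `|complex.Im z|.
Proof.
rewrite {1}(complexE z) (le_trans (normcD _ _))// normcM normc_i mul1r.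
by rewrite !normc_real.
Qed.

Lemma norm_Re_le z : `|complex.Re z| <= normc z.
Proof. by rewrite -lecR -normr_complexE normc_ge_Re. Qed.

Lemma norm_Im_le z : `|complex.Im z| <= normc z.
Proof.
case: z => a b /=; rewrite -sqrtr_sqr ler_wsqrtr// lerDr; exact: sqr_ge0.
Qed.

End modulus.

(** * Exponential sums *)

Section exponential_sums.
Context {R : realType}.
Implicit Types (t l : R) (s : seq (R[i] * R)) (r : seq (R * R)).

Definition cis t : R[i] := (cos t +i* sin t)%C.

Lemma cis0 : cis 0 = 1.
Proof. by rewrite /cis cos0 sin0. Qed.

Lemma cisD t u : cis (t + u) = cis t * cis u.
Proof. by rewrite /cis cosD sinD; simpc; congr (_ +i* _)%C; ring. Qed.

Lemma cisN t : cis (- t) = (cis t)^*%C.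
Proof. by rewrite /cis cosN sinN. Qed.

Lemma normc_cis t : normc (cis t) = 1.
Proof. by rewrite /= cos2Dsin2 sqrtr1. Qed.

(** A pair is a coefficient with its frequency. Frequencies may repeat, so concatenation of lists
    gives sums and pairwise combination gives products. *)
Definition expsum s l : R[i] := \sum_(p <- s) p.1 * cis (l * p.2).

Lemma expsum_cat s1 s2 l : expsum (s1 ++ s2) l = expsum s1 l + expsum s2 l.
Proof. by rewrite /expsum big_cat. Qed.

Lemma expsum_allpairs s1 s2 l :
  expsum [seq (p.1 * q.1, p.2 + q.2) | p <- s1, q <- s2] l =
  expsum s1 l * expsum s2 l.
Proof.
rewrite /expsum big_allpairs_dep big_distrl/=; apply: eq_bigr => p _.
rewrite big_distrr/=; apply: eq_bigr => q _.
by rewrite mulrDr cisD mulrACA.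
Qed.

Definition is_expsum (f : R -> R[i]) := exists s, forall l, f l = expsum s l.

Lemma is_expsum_cst (z : R[i]) : is_expsum (fun=> z).
Proof.
exists [:: (z, 0)] => l.
by rewrite /expsum big_seq1/= mulr0 cis0 mulr1.
Qed.

Lemma is_expsumD f g : is_expsum f -> is_expsum g ->
  is_expsum (fun l => f l + g l).
Proof.
by move=> [s fs] [s' gs]; exists (s ++ s') => l; rewrite expsum_cat fs gs.
Qed.

Lemma is_expsumM f g : is_expsum f -> is_expsum g ->
  is_expsum (fun l => f l * g l).
Proof.
move=> [s fs] [s' gs].
exists [seq (p.1 * q.1, p.2 + q.2) | p <- s, q <- s'] => l.
by rewrite expsum_allpairs fs gs.
Qed.

(** Euler's formula, with [1 / (2 i) = - i / 2]. *)
Lemma is_expsum_sin c : is_expsum (fun l => (sin (c * l))%:C%C).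
Proof.
exists [:: ((0 -i* 2^-1)%C, c); ((0 +i* 2^-1)%C, - c)] => l.
rewrite /expsum big_cons big_seq1/= mulrN cisN /cis; simpc.
rewrite (mulrC l c); congr (_ +i* _)%C; last by ring.
by field.
Qed.

Lemma is_expsum_bernstein (x : R -> R) n f :
  is_expsum (fun l => (x l)%:C%C) ->
  is_expsum (fun l => (bernstein (x l) n f)%:C%C).
Proof.
move=> xs; elim: n f => [|n IH] f /=; first exact: is_expsum_cst.
have [s1 E1] : is_expsum (fun l => (1 - x l)%:C%C * (bernstein (x l) n f)%:C%C).
  apply: is_expsumM => //.
  have [s Es] := is_expsumD (is_expsum_cst 1)
    (is_expsumM (is_expsum_cst (-1)) xs).
  by exists s => l; rewrite -Es mulN1r rmorphB rmorph1.
have [s2 E2] := is_expsumM xs (IH (fun k => f k.+1)).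
exists (s1 ++ s2) => l.
by rewrite expsum_cat -E1 -E2 rmorphD !rmorphM.
Qed.

(* Bernstein approximation in the variable [(1 + sin (c l)) / 2]; with
   [c N = pi / 4] it stays away from [0] and [1], so that [asin], which is only
   known to be continuous inside [-1, 1], can be composed with a clamp. *)
Lemma expsum_approx_real (g : R -> R) (N e : R) : continuous g -> 0 < N ->
  0 < e ->
  exists s, forall l, `|l| <= N -> normc (expsum s l - (g l)%:C%C) <= e.
Proof.
move=> cg N0 e0.
pose c : R := pi / 4 / N.
have pi0 : 0 < pi :> R := pi_gt0 R.
have c0 : 0 < c by rewrite !divr_gt0.
pose b := sin (pi / 4) : R.
have b1 : b < 1.
  rewrite /b -[ltRHS]sin_pihalf ltr_sin ?in_itv/=; first lra;
    apply/andP; split; lra.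
have b0 : 0 <= b by rewrite sin_ge0_pi//; apply/andP; split; lra.
pose h (x : R) := g (asin (Num.max (- b) (Num.min b (2 * x - 1))) / c).
have ch : continuous h.
  move=> x; rewrite /h; apply: continuous_comp; last exact: cg.
  apply: cvgM; last exact: cvg_cst.
  pose k (x : R) : R := Num.max (- b) (Num.min b (2 * x - 1)).
  apply: (@continuous_comp _ _ _ k asin).
    have c1 : {for x, continuous (fun x : R => 2 * x - 1 : R^o)}.
      apply: (@cvgB _ R^o); last exact: cvg_cst.
      apply: (@cvgM R _ _ _ (cst 2) id); [exact: cvg_cst|exact: cvg_id].
    have c2 : {for x, continuous (cst b \min (fun x : R => 2 * x - 1 : R^o))}.
      by apply: continuous_min => //; exact: cvg_cst.
    have := @continuous_max _ _ (cst (- b)) _ x (@cvg_cst _ _ _ _ _) c2.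
    exact.
  apply: continuous_asin; rewrite /k; apply/andP; split.
    by rewrite lt_max ltrN2 b1.
  by rewrite gt_max gt_min b1 andbT (le_lt_trans _ b1)//; lra.
have [n hn] := bernstein_approx ch e0.
pose x l : R := (1 + sin (c * l)) / 2.
have x01 l : 0 <= x l <= 1.
  have := sin_geN1 (c * l); have := sin_le1 (c * l); rewrite /x => ? ?.
  by apply/andP; split; lra.
have xs : is_expsum (fun l => (x l)%:C%C).
  have [s Es] := is_expsumM (is_expsumD (is_expsum_cst 1) (is_expsum_sin c))
    (is_expsum_cst (2^-1)%:C%C).
  by exists s => l; rewrite -Es /x rmorphM rmorphD rmorph1.
have [s Es] := is_expsum_bernstein n (fun k => h (k%:R / n%:R)) xs.
exists s => l lN.
rewrite -Es -rmorphB normc_real.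
have := hn _ (x01 l).
(* For [|l| <= N] the clamp is inactive, since [|c l| <= pi / 4], and [asin] recovers [c l]. *)
suff -> : h (x l) = g l by [].
have cl : `|c * l| <= pi / 4.
  rewrite normrM (gtr0_norm c0) /c -(mulrA (pi / 4)) ger_pMr ?divr_gt0//.
  by rewrite mulrC ler_pdivrMr// mul1r.
have {cl}[cl1 cl2] : - (pi / 4) <= c * l /\ c * l <= pi / 4.
  by move: cl; rewrite ler_norml => /andP.
have bl1 : - b <= sin (c * l).
  rewrite /b -sinN leNgt ltr_sin -?leNgt ?in_itv//=; apply/andP; split; lra.
have bl2 : sin (c * l) <= b.
  rewrite /b leNgt ltr_sin -?leNgt ?in_itv//=; apply/andP; split; lra.
rewrite /h /x (_ : 2 * _ - 1 = sin (c * l)); last by field.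
rewrite (min_idPr bl2) (max_idPr bl1) sinK ?in_itv/=; last first.
  by apply/andP; split; lra.
by rewrite mulrAC divff ?mul1r// gt_eqF.
Qed.

Lemma expsum_approx (a : R -> R[i]) (N e : R) :
  continuous (fun l => complex.Re (a l)) ->
  continuous (fun l => complex.Im (a l)) -> 0 < N -> 0 < e ->
  exists s, forall l, `|l| <= N -> normc (expsum s l - a l) <= e.
Proof.
move=> cRe cIm N0 e0; have e20 : 0 < e / 2 by rewrite divr_gt0.
have [s1 E1] := expsum_approx_real cRe N0 e20.
have [s2 E2] := expsum_approx_real cIm N0 e20.
have [s3 E3] : is_expsum (fun l => 'i%C * expsum s2 l).
  by apply: is_expsumM; [exact: is_expsum_cst|exists s2].
exists (s1 ++ s3) => l lN; rewrite expsum_cat -E3.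
rewrite (complexE (a l)) opprD addrACA -mulrBr.
rewrite (le_trans (normcD _ _))// normcM normc_i mul1r.
by rewrite (splitr e) lerD// ?E1 ?E2.
Qed.

Definition complexify r : seq (R[i] * R) := [seq (p.1%:C%C, p.2) | p <- r].

Lemma expsum_complexify r l :
  expsum (complexify r) l = \sum_(p <- r) p.1%:C%C * cis (l * p.2).
Proof. by rewrite /expsum /complexify big_map. Qed.

(* Averaging [f l] with the conjugate of [f (- l)] replaces the coefficients of
   an exponential sum by their real parts, and fixes hermitian functions. *)
Lemma expsum_approx_hermitian (a : R -> R[i]) (N e : R) :
  continuous (fun l => complex.Re (a l)) ->
  continuous (fun l => complex.Im (a l)) ->
  (forall l, a (- l) = (a l)^*%C) -> 0 < N -> 0 < e ->
  exists r, forall l, `|l| <= N -> normc (expsum (complexify r) l - a l) <= e.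
Proof.
move=> cRe cIm ha N0 e0.
have [s Es] := expsum_approx cRe cIm N0 e0.
exists [seq (complex.Re p.1, p.2) | p <- s] => l lN.
have -> : expsum (complexify [seq (complex.Re p.1, p.2) | p <- s]) l =
    (expsum s l + (expsum s (- l))^*%C) / 2.
  rewrite expsum_complexify big_map /expsum rmorph_sum -big_split/= mulr_suml.
  apply: eq_bigr => p _; rewrite rmorphM mulNr cisN/=.
  by rewrite opprK -/(cis _) -mulrDl mulrAC -ReJ_add.
(* As [a] is hermitian, the error of the average is the average of the error at [l] and the
   conjugate of the error at [- l]. *)
have -> : (expsum s l + (expsum s (- l))^*%C) / 2 - a l =
    ((expsum s l - a l) + (expsum s (- l) - a (- l))^*%C) * (2^-1)%:C%C.
  have -> : (expsum s (- l) - a (- l))^*%C = (expsum s (- l))^*%C - a l.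
    by rewrite rmorphB ha; congr (_ - _); exact: conjcK.
  by rewrite fmorphV rmorph_nat; field.
have := Es (- l); rewrite normrN => /(_ lN) H2.
rewrite normcM normc_real ger0_norm ?invr_ge0//.
rewrite ler_pdivrMr// (le_trans (normcD _ _))// normc_conj.
by have := Es l lN; move: H2; set u := normc _; set v := normc _; lra.
Qed.

End exponential_sums.

(** * Exponential sums with nonnegative continuation *)

Section nonnegative_exponential_sums.
Context {R : realType}.
Implicit Types (t l : R) (r : seq (R * R)).

(** The continuation of [expsum (complexify r)], evaluated at [- i t]. *)
Definition rexpsum r t : R := \sum_(p <- r) p.1 * expR (t * p.2).

(** The same list operation multiplies both the exponential sums and their continuations, so
    squaring a list makes its continuation a square. *)
Definition expsum_mul r1 r2 : seq (R * R) :=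
  [seq (p.1 * q.1, p.2 + q.2) | p <- r1, q <- r2].

Lemma rexpsum_mul r1 r2 t :
  rexpsum (expsum_mul r1 r2) t = rexpsum r1 t * rexpsum r2 t.
Proof.
rewrite /rexpsum big_allpairs_dep big_distrl/=; apply: eq_bigr => p _.
rewrite big_distrr/=; apply: eq_bigr => q _.
by rewrite mulrDr expRD mulrACA.
Qed.

Lemma expsum_complexify_mul r1 r2 l :
  expsum (complexify (expsum_mul r1 r2)) l =
  expsum (complexify r1) l * expsum (complexify r2) l.
Proof.
rewrite !expsum_complexify big_allpairs_dep big_distrl/=.
apply: eq_bigr => p _; rewrite big_distrr/=; apply: eq_bigr => q _.
by rewrite mulrDr cisD rmorphM mulrACA.
Qed.

(* [hermitian_sqrtN phi l] is [i sgn(l) (1 - phi l) / 2] when [phi 0 = 1]. *)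
Definition hermitian_sqrtN (phi : R -> R[i]) l : R[i] :=
  'i%C * (phi (Num.min l 0) - phi (Num.max l 0)) / 2.

(** One of the two arguments of [phi] is [0], where [phi] is [1]; the remaining sign of [l]
    disappears in the square, and the factor [i] gives the minus sign. *)
Lemma hermitian_sqrtN_sqr (phi : R -> R[i]) l : phi 0 = 1 ->
  hermitian_sqrtN phi l ^+ 2 = - ((1 - phi l) / 2) ^+ 2.
Proof.
move=> phi0; rewrite /hermitian_sqrtN.
have := @sqr_i R; set i := ('i%C : R[i]) => i2.
by have [l0|/ltW l0] := leP l 0; rewrite ?phi0 -mulrA exprMn i2; field.
Qed.

(** Negation of [l] exchanges the two values of [phi] up to conjugation, which changes the sign of
    their difference; conjugating [i] changes it back. *)
Lemma hermitian_sqrtN_conj (phi : R -> R[i]) l :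
  (forall l, phi (- l) = (phi l)^*%C) ->
  hermitian_sqrtN phi (- l) = (hermitian_sqrtN phi l)^*%C.
Proof.
move=> hphi; rewrite /hermitian_sqrtN -[X in Num.min _ X]oppr0.
rewrite -[X in Num.max _ X]oppr0 -oppr_max -oppr_min !hphi.
rewrite !rmorphM rmorphB fmorphV rmorph_nat/=.
have -> : (0 -i* 1)%C = - 'i%C :> R[i] by simpc.
by rewrite mulNr -mulrN opprB.
Qed.

Lemma continuous_maxr0 : continuous (fun l => Num.max l 0).
Proof.
move=> x.
exact: (@continuous_max R R idfun (cst 0) x cvg_id (@cvg_cst _ _ _ _ _)).
Qed.

Lemma continuous_minr0 : continuous (fun l => Num.min l 0).
Proof.
move=> x.
exact: (@continuous_min R R idfun (cst 0) x cvg_id (@cvg_cst _ _ _ _ _)).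
Qed.

Lemma continuous_half_diff (u v : R -> R) : continuous u -> continuous v ->
  continuous (fun l => (u l - v l) / 2).
Proof.
move=> cu cv x; apply: cvgM; last exact: cvg_cst.
by apply: (@cvgB _ R^o); [exact: cu|exact: cv].
Qed.

Lemma complex_continuous_bounded (a : R -> R[i]) (N : R) :
  continuous (fun l => complex.Re (a l)) ->
  continuous (fun l => complex.Im (a l)) ->
  exists2 M, 0 <= M & forall l, `|l| <= N -> normc (a l) <= M.
Proof.
move=> cRe cIm.
have [M1 M10 H1] := continuous_segment_bounded (- N) N cRe.
have [M2 M20 H2] := continuous_segment_bounded (- N) N cIm.
exists (M1 + M2); first exact: addr_ge0.
move=> l lN; rewrite (le_trans (normc_le_ReIm _))// lerD//.
- by apply: H1; rewrite in_itv/= -ler_norml.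
- by apply: H2; rewrite in_itv/= -ler_norml.
Qed.

Lemma normc_sqrB (z w : R[i]) (M d : R) : normc w <= M ->
  normc (z - w) <= d -> d <= 1 ->
  normc (z ^+ 2 - w ^+ 2) <= d * (1 + 2 * M).
Proof.
move=> wM zw d1.
rewrite (_ : z ^+ 2 - w ^+ 2 = (z - w) * ((z - w) + 2%:R%:C%C * w)); last first.
  by rewrite rmorph_nat; ring.
have H : normc ((z - w) + 2%:R%:C%C * w) <= 1 + 2 * M.
  rewrite (le_trans (normcD _ _))// lerD//; first exact: le_trans zw _.
  by rewrite normcM normc_real ger0_norm// ler_pM2l.
by rewrite normcM ler_pM// normc_ge0.
Qed.

Lemma nonnegative_expsum_approx (phi : R -> R[i]) (N e : R) :
  continuous (fun l => complex.Re (phi l)) ->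
  continuous (fun l => complex.Im (phi l)) ->
  phi 0 = 1 -> (forall l, phi (- l) = (phi l)^*%C) -> 0 < N -> 0 < e ->
  exists2 r, (forall t, 0 <= rexpsum r t) &
    forall l, `|l| <= N -> normc (expsum (complexify r) l - phi l) <= e.
Proof.
move=> cRe cIm phi0 hphi N0 e0.
pose a l : R[i] := (1 + phi l) / 2.
pose b := hermitian_sqrtN phi.
have ab l : phi l = a l ^+ 2 + b l ^+ 2.
  by rewrite /b hermitian_sqrtN_sqr// /a; field.
have ha l : a (- l) = (a l)^*%C.
  by rewrite /a hphi rmorphM rmorphD rmorph1 fmorphV rmorph_nat.
have hb l : b (- l) = (b l)^*%C by exact: hermitian_sqrtN_conj.
have halfE : (2^-1 : R[i]) = (2^-1)%:C%C by rewrite fmorphV rmorph_nat.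
have ReaE : (fun l => complex.Re (a l)) =
    fun l => (complex.Re (phi l) - (-1)) / 2.
  apply/funext => l; rewrite /a halfE.
  by case: (phi l) => u v; simpc => /=; ring.
have ImaE : (fun l => complex.Im (a l)) =
    fun l => (complex.Im (phi l) - 0) / 2.
  apply/funext => l; rewrite /a halfE.
  by case: (phi l) => u v; simpc => /=; ring.
have RebE : (fun l => complex.Re (b l)) = fun l =>
    (complex.Im (phi (Num.max l 0)) - complex.Im (phi (Num.min l 0))) / 2.
  apply/funext => l; rewrite /b /hermitian_sqrtN halfE.
  by case: (phi _) => u v; case: (phi _) => u' v'; simpc => /=; ring.
have ImbE : (fun l => complex.Im (b l)) = fun l =>
    (complex.Re (phi (Num.min l 0)) - complex.Re (phi (Num.max l 0))) / 2.
  apply/funext => l; rewrite /b /hermitian_sqrtN halfE.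
  by case: (phi _) => u v; case: (phi _) => u' v'; simpc => /=; ring.
(* Writing [b] with [min] and [max] makes its continuity, also at [0], a matter of composition. *)
have cm (u : R -> R) : continuous u -> continuous (fun l => u (Num.max l 0)).
  by move=> cu x; apply: continuous_comp; [exact: continuous_maxr0|exact: cu].
have cn (u : R -> R) : continuous u -> continuous (fun l => u (Num.min l 0)).
  by move=> cu x; apply: continuous_comp; [exact: continuous_minr0|exact: cu].
have cRea : continuous (fun l => complex.Re (a l)).
  by rewrite ReaE; apply: continuous_half_diff => //; exact: cst_continuous.
have cIma : continuous (fun l => complex.Im (a l)).
  by rewrite ImaE; apply: continuous_half_diff => //; exact: cst_continuous.
have cReb : continuous (fun l => complex.Re (b l)).
  rewrite RebE; apply: continuous_half_diff; first exact: (cm _ cIm).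
  exact: (cn _ cIm).
have cImb : continuous (fun l => complex.Im (b l)).
  rewrite ImbE; apply: continuous_half_diff; first exact: (cn _ cRe).
  exact: (cm _ cRe).
have [Ma Ma0 aM] := complex_continuous_bounded N cRea cIma.
have [Mb Mb0 bM] := complex_continuous_bounded N cReb cImb.
pose K := 1 + 2 * Ma + (1 + 2 * Mb).
have K0 : 0 < K by rewrite /K; lra.
(* This gives both [d <= 1], required by [normc_sqrB], and [d K <= e]. *)
pose d := e / (K + e).
have Ke0 : 0 < K + e by exact: addr_gt0.
have d0 : 0 < d by exact: divr_gt0.
have d1 : d <= 1 by rewrite /d ler_pdivrMr// mul1r; lra.
have dK : d * K <= e.
  by rewrite /d mulrAC ler_pdivrMr// ler_wpM2l ?(ltW e0)//; lra.
have [r1 E1] := expsum_approx_hermitian cRea cIma ha N0 d0.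
have [r2 E2] := expsum_approx_hermitian cReb cImb hb N0 d0.
(* The continuation is a sum of two real squares, because the coefficients of [r1] and [r2] are
   real. *)
exists (expsum_mul r1 r1 ++ expsum_mul r2 r2) => [t|l lN].
  rewrite /rexpsum big_cat/= addr_ge0// -/(rexpsum _ _) rexpsum_mul -expr2;
    exact: sqr_ge0.
rewrite /complexify map_cat expsum_cat -!/(complexify _) !expsum_complexify_mul.
rewrite ab -!expr2 opprD addrACA (le_trans (normcD _ _))// (le_trans _ dK)//.
rewrite /K mulrDr lerD//; apply: normc_sqrB => //.
- exact: aM.
- exact: E1.
- exact: bM.
- exact: E2.
Qed.

End nonnegative_exponential_sums.

(** * The Fourier transform of the normal density *)

(** The integral over [[- n - 1, n + 1]] is a difference of boundary values, which tends to [0]; by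
    dominated convergence it also tends to the full integral. *)
Lemma integral_derive_eq0 (R : realType) (F f : R -> R) :
  (forall x : R, is_derive x 1 F (f x)) -> continuous f ->
  lebesgue_measure.-integrable setT (EFin \o f) ->
  F n%:R @[n --> \oo] --> (0 : R) -> F (- n%:R) @[n --> \oo] --> (0 : R) ->
  \int[lebesgue_measure]_x f x = 0.
Proof.
move=> dF cf intf Fy FNy.
have cF : continuous F.
  by move=> x; apply: differentiable_continuous; apply/derivable1_diffP.
(* The successor keeps the interval nondegenerate at [n = 0], as the fundamental theorem
   requires. *)
pose I (n : nat) : set R := `[- n.+1%:R, n.+1%:R]%classic.
have intI n : \int[lebesgue_measure]_(x in I n) f x = F n.+1%:R - F (- n.+1%:R).
  rewrite /Rintegral /I (@continuous_FTC2 _ _ F)//.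
  - by rewrite (@lt_trans _ _ 0)// oppr_lt0.
  - exact: continuous_subspaceT.
  - split; first by move=> x _; exact: ex_derive.
      exact/cvg_at_right_filter/cF.
    exact/cvg_at_left_filter/cF.
  - by move=> x _; rewrite derive1E; exact: derive_val.
have I0 : (\int[lebesgue_measure]_(x in I n) f x) @[n --> \oo] --> (0 : R).
  under eq_fun do rewrite intI.
  have FB : (F n%:R - F (- n%:R)) @[n --> \oo] --> (0 - 0 : R).
    by apply: (@cvgB _ R^o).
  by move: FB; rewrite subr0 -cvg_shiftS.
suff : (\int[lebesgue_measure]_(x in I n) f x) @[n --> \oo] -->
    \int[lebesgue_measure]_x f x.
  by move/(cvg_unique _ I0) => <-.
under eq_fun do rewrite Rintegral_mkcond.
have mf : measurable_fun setT f.
  by move/measurable_int : intf => /measurable_EFinP.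
apply: fine_cvg; rewrite fineK ?integrable_fin_num//.
apply: (@dominated_cvg _ _ _ lebesgue_measure setT _ _ _
  (EFin \o (fun x => `|f x|))) => //=.
- move=> n; apply/measurable_EFinP; apply/(measurable_restrictT _ _).1.
    exact: measurable_itv.
  exact: measurable_funTS.
- move=> x _; apply: cvg_EFin; first exact: nearW.
  apply: cvg_near_cst; near=> n; rewrite /= patchE ifT//.
  rewrite inE /I/= in_itv/= -ler_norml.
  rewrite (@le_trans _ _ n%:R) ?ler_nat//; near: n.
  exact: nbhs_infty_ger.
- by apply: integrable_abse intf.
- by move=> n x _; rewrite lee_fin patchE; case: ifP => //; rewrite normr0.
Unshelve. all: by end_near. Qed.

Section gaussian_fourier.
Context {R : realType}.
Local Notation mu := lebesgue_measure.
Variables (m s : R).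
Hypothesis s0 : 0 < s.
Let s_neq0 : s != 0. Proof. by rewrite gt_eqF. Qed.

Local Notation u := (normal_pdf m s).

Lemma bounded_mul_normal_pdf_integrable (f : R -> R) (K : R) :
  measurable_fun setT f -> (forall x, `|f x| <= K) ->
  mu.-integrable setT (EFin \o (fun x => f x * u x)).
Proof.
move=> mf fK.
apply: (@le_integrable _ _ _ mu setT _ _ (fun x => K%:E * (u x)%:E)%E) => //.
- by apply/measurable_EFinP/measurable_funM => //; exact: measurable_normal_pdf.
- move=> x _ /=; rewrite lee_fin !normrM ler_wpM2r//.
  by rewrite (le_trans (fK x))// ler_norm.
- by apply: integrableZl => //; exact: integrable_normal_pdf.
Qed.

(* [`|y| <= s (1 + y ^+ 2 / (4 s ^+ 2)) <= s expR (y ^+ 2 / (4 s ^+ 2))], so the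
   first moment is dominated by a Gaussian of larger variance. *)
Lemma normal_pdf_moment1_integrable :
  mu.-integrable setT (EFin \o (fun x => `|x - m| * u x)).
Proof.
pose s' := Num.sqrt 2 * s.
have s'2 : s' ^+ 2 = 2 * s ^+ 2 by rewrite exprMn sqr_sqrtr.
have s'0 : s' != 0 by rewrite mulf_neq0// gt_eqF// sqrtr_gt0.
pose K := s * normal_peak s / normal_peak s'.
apply: (@le_integrable _ _ _ mu setT _ _
  (fun x => K%:E * (normal_pdf m s' x)%:E)%E) => //.
- apply/measurable_EFinP/measurable_funM; last exact: measurable_normal_pdf.
  by apply: measurableT_comp => //; exact: measurable_funB.
- move=> x _ /=; rewrite lee_fin.
  rewrite ger0_norm ?mulr_ge0 ?normal_pdf_ge0// (le_trans _ (ler_norm _))//.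
  suff H : `|x - m| * normal_fun m s x <= s * normal_fun m s' x.
    rewrite !normal_pdfE// /K mulrCA.
    rewrite [leRHS](_ : _ = normal_peak s * (s * normal_fun m s' x));
      last first.
      by field; rewrite gt_eqF ?normal_peak_gt0.
    by rewrite ler_wpM2l ?normal_peak_ge0.
  rewrite /normal_fun; set y := x - m; set b := y ^+ 2 / (4 * s ^+ 2).
  have -> : - y ^+ 2 / (s ^+ 2 *+ 2) = - y ^+ 2 / (s' ^+ 2 *+ 2) - b.
    by rewrite /b s'2; field.
  rewrite expRD expRN mulrA mulrAC ler_wpM2r ?expR_ge0//.
  rewrite ler_pdivrMr ?expR_gt0//.
  apply: (@le_trans _ _ (s * (1 + b))); last first.
    by rewrite ler_wpM2l ?expR_ge1Dx// ltW.
  have -> : s * (1 + b) = `|y| + (`|y| / 2 - s) ^+ 2 / s.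
    rewrite /b -[y ^+ 2]real_normK ?num_real//; by field.
  by rewrite lerDl divr_ge0 ?sqr_ge0// ltW.
- by apply: integrableZl => //; exact: integrable_normal_pdf.
Qed.

Lemma integrable_mul_normal_pdf_moment1 (f : R -> R) :
  measurable_fun setT f -> (forall x, `|f x| <= 1) ->
  mu.-integrable setT (EFin \o (fun x => (x - m) * f x * u x)).
Proof.
move=> mf f1.
apply: le_integrable normal_pdf_moment1_integrable => //=.
- apply/measurable_EFinP/measurable_funM; last exact: measurable_normal_pdf.
  by apply: measurable_funM => //; exact: measurable_funB.
- move=> x _ /=; rewrite lee_fin !normrM normr_id ler_wpM2r// ler_piMr//.
Qed.

(* The phase [c] gives access to both [cos (l * x)] and [sin (l * x)] while the
   differential equation in [l] stays scalar. *)
Definition phase_cos (c l x : R) : R := cos (l * (x - m) + c).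
Definition phase_sin (c l x : R) : R := sin (l * (x - m) + c).

Lemma is_derive_normal_pdf (x : R) :
  is_derive x 1 u (- (x - m) / s ^+ 2 * u x).
Proof.
rewrite normal_pdfE//.
pose k : R := (s ^+ 2 *+ 2)^-1.
pose g : R -> R := k *: (- (id - cst m : R -> R) ^+ 2).
have dg : is_derive x 1 g (- (x - m) / s ^+ 2).
  by apply: is_derive_eq; rewrite /GRing.scale/= !fctE/= /k subr0; field.
have -> : (fun x => normal_peak s * normal_fun m s x) =
    normal_peak s *: (expR \o g).
  apply/funext => y; rewrite /normal_fun -[RHS]/(_ * expR (k * - (y - m) ^+ 2)).
  by rewrite (mulrC k).
apply: is_derive_eq.
rewrite -[LHS]/(normal_peak s *
  (expR (k * - (x - m) ^+ 2) * (- (x - m) / s ^+ 2))).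
by rewrite /normal_fun (mulrC k) mulrA [RHS]mulrC.
Qed.

Lemma is_derive_phase_sin (c l x : R) :
  is_derive x 1 (phase_sin c l) (l * phase_cos c l x).
Proof.
have dg : is_derive x 1 (l *: (id - cst m : R -> R) + cst c) l.
  by apply: is_derive_eq; rewrite /GRing.scale/= subr0 addr0 mulr1.
apply: (@is_derive_eq _ _ _ (sin \o (l *: (id - cst m : R -> R) + cst c))).
by rewrite mulrC.
Qed.

Lemma is_derive_phase_cos (c x l : R) :
  is_derive l 1 (phase_cos c ^~ x) (- (x - m) * phase_sin c l x).
Proof.
have dg : is_derive l 1 ((x - m) *: (id : R -> R) + cst c) (x - m).
  by apply: is_derive_eq; rewrite /GRing.scale/= addr0 mulr1.
have -> : phase_cos c ^~ x = cos \o ((x - m) *: (id : R -> R) + cst c).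
  by apply/funext => y; rewrite /phase_cos/= !fctE /GRing.scale/= mulrC.
apply: is_derive_eq.
rewrite -[LHS]/(- sin ((x - m) * l + c) * (x - m)).
by rewrite /phase_sin (mulrC l) !mulNr; congr (- _); exact: mulrC.
Qed.

(** In terms of [w = |x - m| / s] this is [w <= exp (w^2 / 2)], which follows from
    [w <= 1 + w^2 / 2]. *)
Lemma normal_pdf_decay (x : R) : `|x - m| * u x <= s * normal_peak s.
Proof.
rewrite normal_pdfE// mulrCA [leRHS]mulrC ler_wpM2l ?normal_peak_ge0//.
rewrite /normal_fun mulNr expRN ler_pdivrMr ?expR_gt0//.
set v := x - m; have {1}-> : `|v| = s * (`|v| / s) by field.
rewrite ler_wpM2l ?(ltW s0)// (le_trans _ (expR_ge1Dx _))//.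
have -> : v ^+ 2 / (s ^+ 2 *+ 2) = (`|v| / s) ^+ 2 / 2.
  by rewrite -[v ^+ 2]real_normK ?num_real//; field.
move: (`|v| / s) => w; rewrite -subr_ge0.
have -> : 1 + w ^+ 2 / 2 - w = ((w - 1) ^+ 2 + 1) / 2 by field.
by rewrite divr_ge0 ?addr_ge0 ?sqr_ge0.
Qed.

Lemma normal_pdf_cvg0 (y : R^nat) : (forall n, n%:R <= `|y n|) ->
  u (y n) @[n --> \oo] --> (0 : R).
Proof.
move=> ny; apply/cvgrPdist_le => /= e e0.
near=> n; rewrite sub0r normrN ger0_norm ?normal_pdf_ge0//.
(* The term [|m|] absorbs the centering, the quotient brings the bound of [normal_pdf_decay] below
   [e], and [1] keeps [|y n - m|] positive. *)
have nm : `|m| + s * normal_peak s / e + 1 <= n%:R.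
  by near: n; exact: nbhs_infty_ger.
have ynm : s * normal_peak s / e + 1 <= `|y n - m|.
  rewrite (le_trans _ (lerB_normD _ _))// normrN lerBrDl.
  by rewrite addrA (le_trans nm).
have C0 : 0 <= s * normal_peak s / e.
  by rewrite divr_ge0 ?mulr_ge0 ?normal_peak_ge0// ltW.
have ynm0 : 0 < `|y n - m| by rewrite (lt_le_trans _ ynm)// ltr_pwDr.
rewrite -(ler_pM2l ynm0) (le_trans (normal_pdf_decay _))//.
by rewrite -ler_pdivrMr// (le_trans _ ynm)// lerDl.
Unshelve. all: by end_near. Qed.

Lemma continuous_phase_cos c l : continuous (phase_cos c l).
Proof.
move=> x; apply: (@continuous_comp _ _ _ (fun x => l * (x - m) + c) cos).
  apply: (@cvgD _ R^o); last exact: cvg_cst.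
  apply: (@cvgM R _ _ _ (cst l) (fun x => x - m)); first exact: cvg_cst.
  by apply: (@cvgB _ R^o); [exact: cvg_id|exact: cvg_cst].
exact: continuous_cos.
Qed.

Lemma continuous_phase_sin c l : continuous (phase_sin c l).
Proof.
move=> x; apply: (@continuous_comp _ _ _ (fun x => l * (x - m) + c) sin).
  apply: (@cvgD _ R^o); last exact: cvg_cst.
  apply: (@cvgM R _ _ _ (cst l) (fun x => x - m)); first exact: cvg_cst.
  by apply: (@cvgB _ R^o); [exact: cvg_id|exact: cvg_cst].
exact: continuous_sin.
Qed.

Lemma integrable_phase_cos c l :
  mu.-integrable setT (EFin \o (fun x => phase_cos c l x * u x)).
Proof.
apply: (@bounded_mul_normal_pdf_integrable _ 1).
  by apply: continuous_measurable_fun; exact: continuous_phase_cos.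
by move=> x; rewrite ler_norml cos_geN1 cos_le1.
Qed.

Lemma integrable_moment_phase_sin c l :
  mu.-integrable setT (EFin \o (fun x => (x - m) * phase_sin c l x * u x)).
Proof.
apply: integrable_mul_normal_pdf_moment1.
  by apply: continuous_measurable_fun; exact: continuous_phase_sin.
by move=> x; rewrite ler_norml sin_geN1 sin_le1.
Qed.

Lemma phase_sin_normal_pdf_cvg0 c l (k : R) (y : R^nat) :
  (forall n, n%:R <= `|y n|) ->
  k * (phase_sin c l (y n) * u (y n)) @[n --> \oo] --> (0 : R).
Proof.
move=> ny; apply: norm_cvg0.
apply: (@squeeze_cvgr _ _ _ _ (cst 0) (fun n => `|k| * u (y n))).
- apply: nearW => n; rewrite normr_ge0/= !normrM ler_wpM2l//.
  rewrite [X in _ * X]ger0_norm ?normal_pdf_ge0//.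
  by rewrite ler_piMl ?normal_pdf_ge0// ler_norml sin_geN1 sin_le1.
- exact: cvg_cst.
- rewrite -(mulr0 `|k|); apply: cvgM; first exact: cvg_cst.
  exact: normal_pdf_cvg0.
Qed.

(** Integration by parts: as [u' = - (x - m) / s^2 u], the difference of the two integrands is, up
    to sign, the derivative of [s^2 sin (l (x - m) + c) u], which vanishes at infinity. *)
Lemma integral_moment_phase_sin c l :
  \int[mu]_x ((x - m) * phase_sin c l x * u x) =
  s ^+ 2 * l * \int[mu]_x (phase_cos c l x * u x).
Proof.
have IC := integrable_phase_cos c l.
have IS := integrable_moment_phase_sin c l.
pose f x :=
  s ^+ 2 * l * (phase_cos c l x * u x) - (x - m) * phase_sin c l x * u x.
have IC' : mu.-integrable setT
    (EFin \o (fun x => s ^+ 2 * l * (phase_cos c l x * u x))).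
  apply: eq_integrable (integrableZl measurableT (s ^+ 2 * l) IC) => //.
have : \int[mu]_x f x = 0.
  apply: (@integral_derive_eq0 _ (fun x => s ^+ 2 * (phase_sin c l x * u x)) f).
  - move=> x.
    have dS := is_derive_phase_sin c l x; have du := is_derive_normal_pdf x.
    apply: (@is_derive_eq _ _ _ (s ^+ 2 *: (phase_sin c l * u))).
    rewrite /GRing.scale/= /f; by field.
  - move=> x; apply: (@cvgB _ R^o).
      apply: cvgM; first exact: cvg_cst.
      apply: cvgM; first exact: continuous_phase_cos.
      exact: continuous_normal_pdf.
    apply: cvgM; last exact: continuous_normal_pdf.
    apply: cvgM; last exact: continuous_phase_sin.
    by apply: (@cvgB _ R^o); [exact: cvg_id|exact: cvg_cst].
  - apply: eq_integrable (integrableB measurableT IC' IS) => //.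
  - by apply: phase_sin_normal_pdf_cvg0 => n; rewrite normr_nat.
  - by apply: phase_sin_normal_pdf_cvg0 => n; rewrite normrN normr_nat.
rewrite /f RintegralB// RintegralZl// => /eqP; rewrite subr_eq0 => /eqP <-.
by [].
Qed.

(** The real part of [exp (i c)] times the characteristic function at [l] of a centered normal
    variable of variance [s^2]. *)
Definition gaussian_phase c l := (\int[mu]_x (phase_cos c l x * u x))%R.

Lemma is_derive_phase_cos_pdf (c x l : R) :
  is_derive l 1 (fun l => phase_cos c l x * u x)
    (- ((x - m) * phase_sin c l x * u x)).
Proof.
have dC := is_derive_phase_cos c x l.
apply: (@is_derive_eq _ _ _ (phase_cos c ^~ x * cst (u x))).
rewrite /GRing.scale/= mulr0 add0r.
by rewrite mulrC !mulNr.
Qed.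

(** Differentiation under the integral on []l - 1, l + 1[], dominated by the first absolute moment,
    and then [integral_moment_phase_sin] yield a linear differential equation. *)
Lemma is_derive_gaussian_phase c (l : R) :
  is_derive l 1 (gaussian_phase c) (- (s ^+ 2 * l * gaussian_phase c l)).
Proof.
pose f l x := phase_cos c l x * u x.
have ll : `]l - 1, l + 1[%classic l.
  by rewrite /= in_itv/=; apply/andP; split; lra.
have intf (l' : R) : `]l - 1, l + 1[%classic l' ->
    mu.-integrable setT (EFin \o f l').
  by move=> _; exact: integrable_phase_cos.
have df (l' y : R) : `]l - 1, l + 1[%classic l' -> [set: R] y ->
    derivable (f ^~ y) l' 1.
  by move=> _ _; case: (is_derive_phase_cos_pdf c y l').
have partialE l' y : partial1of2 f l' y = - ((y - m) * phase_sin c l' y * u y).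
  by rewrite partial1of2E; case: (is_derive_phase_cos_pdf c y l').
have G0 (y : R) : 0 <= `|y - m| * u y by rewrite mulr_ge0 ?normal_pdf_ge0.
have fG (l' y : R) : `]l - 1, l + 1[%classic l' -> [set: R] y ->
    `|partial1of2 f l' y| <= `|y - m| * u y.
  move=> _ _.
  rewrite partialE normrN !normrM (ger0_norm (normal_pdf_ge0 _ _ _)).
  rewrite ler_wpM2r ?normal_pdf_ge0// ler_piMr//.
  by rewrite ler_norml sin_geN1 sin_le1.
split.
  exact: (derivable_under_integral measurableT ll intf df G0
    normal_pdf_moment1_integrable fG).
rewrite -derive1E (differentiation_under_integral measurableT ll intf df G0
    normal_pdf_moment1_integrable fG).
under eq_Rintegral do rewrite partialE -mulN1r.
rewrite RintegralZl//= ?integral_moment_phase_sin ?mulN1r//.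
exact: integrable_moment_phase_sin.
Qed.

(** Multiplication by the integrating factor [exp (s^2 l^2 / 2)] gives zero derivative, so the
    product keeps its value [cos c] at [l = 0]. *)
Lemma gaussian_phaseE c (l : R) :
  gaussian_phase c l = cos c * expR (- (s ^+ 2 * l ^+ 2 / 2)).
Proof.
pose g : R -> R := (s ^+ 2 / 2) *: ((id : R -> R) ^+ 2).
have dh (x : R) : is_derive x 1 (gaussian_phase c * (expR \o g)) 0.
  have dp := is_derive_gaussian_phase c x.
  have dg : is_derive x 1 g (s ^+ 2 * x).
    apply: is_derive_eq; rewrite /GRing.scale/=. by field.
  apply: is_derive_eq; rewrite /GRing.scale/= [X in _ + X]mulrC; ring.
have := is_derive_0_is_cst l 0 dh.
have gE x : g x = s ^+ 2 * x ^+ 2 / 2 by rewrite -[LHS]/(_ / 2 * x ^+ 2); field.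
have -> : (gaussian_phase c * (expR \o g)) l =
  gaussian_phase c l * expR (s ^+ 2 * l ^+ 2 / 2) by rewrite -gE.
have -> : (gaussian_phase c * (expR \o g)) 0 =
  gaussian_phase c 0 * expR (s ^+ 2 * 0 ^+ 2 / 2) by rewrite -gE.
rewrite expr0n/= mulr0 mul0r expR0 mulr1.
have -> : gaussian_phase c 0 = cos c.
  rewrite /gaussian_phase.
  under eq_Rintegral do rewrite /phase_cos mul0r add0r.
  rewrite RintegralZl//; last exact: integrable_normal_pdf.
  by rewrite /Rintegral integral_normal_pdf/= mulr1.
by move=> <-; rewrite expRN mulfK// gt_eqF// expR_gt0.
Qed.

End gaussian_fourier.

(** The phase [c = l m] undoes the centering. *)
Lemma normal_pdf_cos (R : realType) (m s l : R) : 0 < s ->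
  \int[lebesgue_measure]_x (cos (l * x) * normal_pdf m s x) =
  cos (l * m) * expR (- (s ^+ 2 * l ^+ 2 / 2)).
Proof.
move=> s0; rewrite -(gaussian_phaseE m s0); apply: eq_Rintegral => x _.
by rewrite /phase_cos mulrBr subrK.
Qed.

(** A sine is a cosine with phase shifted by [- pi / 2], so here [c = l m - pi / 2]. *)
Lemma normal_pdf_sin (R : realType) (m s l : R) : 0 < s ->
  \int[lebesgue_measure]_x (sin (l * x) * normal_pdf m s x) =
  sin (l * m) * expR (- (s ^+ 2 * l ^+ 2 / 2)).
Proof.
move=> s0; have sE (y : R) : sin y = cos (y - pi / 2).
  by rewrite cosB cos_pihalf sin_pihalf mulr0 add0r mulr1.
rewrite sE -(gaussian_phaseE m s0); apply: eq_Rintegral => x _.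
by rewrite sE /phase_cos mulrBr addrA subrK.
Qed.

(** * Probability measures with a density *)

Lemma density_probability (R : realType) (p : R -> R) :
  (forall x, 0 <= p x) ->
  lebesgue_measure.-integrable setT (EFin \o p) ->
  \int[lebesgue_measure]_x p x = 1 ->
  exists P : probability (measurableTypeR R) R,
    forall (f : R -> R) (K : R), measurable_fun setT f ->
      (forall x, `|f x| <= K) ->
      fine (\int[P]_x (f x)%:E)%E = \int[lebesgue_measure]_x (f x * p x).
Proof.
move=> p0 ip p1.
pose nu (A : set (measurableTypeR R)) : \bar R :=
  (\int[lebesgue_measure]_(x in A) (p x)%:E)%E.
have nu0 : nu set0 = 0%E by rewrite /nu integral_set0.
have nu_ge0 A : (0 <= nu A)%E.
  by apply: integral_ge0 => x _; rewrite lee_fin.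
have nu_sigma : semi_sigma_additive nu.
  move=> A mA tA mUA; rewrite /nu integral_bigcup//=; last first.
    exact: (integrableS _ _ (subsetT _)).
  apply: is_cvg_ereal_nneg_natsum_cond => n _ _.
  by apply: integral_ge0 => x _; rewrite lee_fin.
have nuT : nu setT = 1%E.
  rewrite /nu -(fineK (integrable_fin_num measurableT ip)).
  by rewrite -[X in _ = X%:E]p1.
pose M : {measure set (measurableTypeR R) -> \bar R} :=
  HB.pack nu (isMeasure.Build _ _ _ nu nu0 nu_ge0 nu_sigma).
pose P : probability (measurableTypeR R) R :=
  HB.pack nu M (Measure_isProbability.Build _ _ R M nuT).
exists P => f K mf fK.
have mp : measurable_fun setT p.
  by move/measurable_int : ip => /measurable_EFinP.
have Pmu : P `<< lebesgue_measure.
  apply/null_content_dominatesP => A mA A0.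
  apply: null_set_integral => //.
  exact/measurable_EFinP/measurable_funTS.
have iP : P.-integrable setT (EFin \o f).
  apply: (@le_integrable _ _ _ P setT _ _ (cst K%:E)) => //.
  - exact/measurable_EFinP.
  - by move=> x _; rewrite /= lee_fin (le_trans (fK x))// ler_norm.
  - exact: finite_measure_integrable_cst.
(* The Radon-Nikodym derivative and [p] have the same integral over every measurable set, so they
   agree almost everywhere. *)
rewrite -(Radon_Nikodym_change_of_variables Pmu measurableT iP) /Rintegral.
have dPp : ae_eq lebesgue_measure setT
    ('d (charge_of_finite_measure P) '/d lebesgue_measure) (EFin \o p).
  apply: integral_ae_eq => //.
  - exact: Radon_Nikodym_integrable.
  - exact/measurable_EFinP.
  - move=> A _ mA; by rewrite -Radon_Nikodym_integral.
congr fine; apply: ae_eq_integral => //.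
- apply: emeasurable_funM; first exact/measurable_EFinP.
  exact/measurable_int/Radon_Nikodym_integrable.
- by apply/measurable_EFinP/measurable_funM.
- exact: (ae_eqe_mul2l _ dPp).
Qed.

(** * Characteristic functions *)

Section characteristic_functions.
Context {R : realType}.

Lemma cexp_i (t : R) : cexp ('i%C * t%:C%C) = cis t.
Proof. by rewrite /cexp; simpc; rewrite /= expR0 !mul1r. Qed.

Lemma charfunE d (T : measurableType d) (P : probability T R)
    (X : {RV P >-> R}) (l : R) :
  charfun X l = (\int[P]_w cos (l * X w) +i* \int[P]_w sin (l * X w))%C.
Proof.
rewrite /charfun /cexpectation unlock /Rintegral.
by congr (fine _ +i* fine _)%C; apply: eq_integral => w _; rewrite cexp_i.
Qed.

Lemma gaussian_charfunE (m s l : R) : gaussian_charfun m s l =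
  (expR (- (s ^+ 2 * l ^+ 2 / 2)))%:C%C * cis (m * l) :> R[i].
Proof. by rewrite /gaussian_charfun /cexp /cis; simpc. Qed.

Lemma gaussian_charfun_neq0 (m s l : R) : (gaussian_charfun m s l : R[i]) != 0.
Proof.
rewrite gaussian_charfunE; apply/eqP => /(congr1 (@normc R)).
rewrite normcM normc_real normc_cis mulr1 normc0 => /eqP.
by rewrite normr_eq0 gt_eqF ?expR_gt0.
Qed.

Lemma continuous_complex (phi : R -> R[i]) :
  continuous (fun l => complex.Re (phi l)) ->
  continuous (fun l => complex.Im (phi l)) ->
  continuous (phi : R -> R[i]^o).
Proof.
move=> cRe cIm x; apply/cvgrPdist_lt => e e0.
(* The radius [e] is an element of [R[i]]; being positive, it is real. *)
have eE : e = (complex.Re e)%:C%C by rewrite RRe_real// gtr0_real.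
have e20 : 0 < complex.Re e / 2.
  by rewrite divr_gt0//; move: e0; rewrite eE ltcR.
have /cvgrPdist_lt/(_ _ e20) H1 := cRe x.
have /cvgrPdist_lt/(_ _ e20) H2 := cIm x.
near=> y; rewrite eE normr_complexE ltcR.
rewrite (le_lt_trans (normc_le_ReIm _))//.
have h1 : `|complex.Re (phi x) - complex.Re (phi y)| < complex.Re e / 2.
  by near: y.
have h2 : `|complex.Im (phi x) - complex.Im (phi y)| < complex.Re e / 2.
  by near: y.
have -> : complex.Re (phi x - phi y) = complex.Re (phi x) - complex.Re (phi y).
  by case: (phi x) => ? ?; case: (phi y).
have -> : complex.Im (phi x - phi y) = complex.Im (phi x) - complex.Im (phi y).
  by case: (phi x) => ? ?; case: (phi y).
by rewrite (splitr (complex.Re e)) ltrD.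
Unshelve. all: by end_near. Qed.

Lemma continuous_Re (phi : R -> R[i]) : continuous (phi : R -> R[i]^o) ->
  continuous (fun l => complex.Re (phi l)).
Proof.
move=> cphi x; apply/cvgrPdist_lt => e e0.
have /cvgrPdist_lt/(_ e%:C%C) := cphi x; rewrite ltcR => /(_ e0).
apply: filterS => y; rewrite normr_complexE ltcR; apply: le_lt_trans.
apply: le_trans (norm_Re_le _).
by case: (phi x) => ? ?; case: (phi y).
Qed.

Lemma continuous_Im (phi : R -> R[i]) : continuous (phi : R -> R[i]^o) ->
  continuous (fun l => complex.Im (phi l)).
Proof.
move=> cphi x; apply/cvgrPdist_lt => e e0.
have /cvgrPdist_lt/(_ e%:C%C) := cphi x; rewrite ltcR => /(_ e0).
apply: filterS => y; rewrite normr_complexE ltcR; apply: le_lt_trans.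
apply: le_trans (norm_Im_le _).
by case: (phi x) => ? ?; case: (phi y).
Qed.

Section continuity.
Context d (T : measurableType d) (P : probability T R) (X : {RV P >-> R}).

Lemma integrable_comp_RV (h : R -> R) (l : R) : continuous h ->
  (forall x, `|h x| <= 1) ->
  P.-integrable setT (EFin \o (fun w => h (l * X w))).
Proof.
move=> ch h1.
apply: (@le_integrable _ _ _ P setT _ _ (EFin \o cst 1)) => //.
- apply/measurable_EFinP.
  apply: measurableT_comp; first exact: continuous_measurable_fun.
  exact: measurable_funM.
- by move=> w _; rewrite /= lee_fin normr1.
- exact: finite_measure_integrable_cst.
Qed.

(** Dominated convergence with bound [1], integrable since [P] is finite. *)
Lemma continuous_Rintegral_comp (h : R -> R) : continuous h ->
  (forall x, `|h x| <= 1) ->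
  continuous (fun l : R => (\int[P]_w h (l * X w))%R).
Proof.
move=> ch h1 x.
apply: (@continuity_under_integral _ _ _ P (fun l w => h (l * X w)) setT
  measurableT (x - 1) (x + 1) _ _ (cst 1)) => //.
- by move=> l _; exact: integrable_comp_RV.
- apply: aeW => w _ l _.
  have cl : {for l, continuous (fun l : R => l * X w)}.
    by apply: cvgM; [exact: cvg_id|exact: cvg_cst].
  exact: (continuous_comp cl (ch _)).
- exact: finite_measure_integrable_cst.
- by move=> l _; apply: aeW => w _.
- rewrite inE/= in_itv/=; apply/andP; split; lra.
Qed.

End continuity.

Lemma setS0_sub_setS : setS0 R `<=` setS R.
Proof.
move=> phi [d [T [P [X [m [s [s0 phiE]]]]]]].
pose C l := \int[P]_w cos (l * X w).
pose S l := \int[P]_w sin (l * X w).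
pose E l := expR (s ^+ 2 * l ^+ 2 / 2).
have cC : continuous C.
  apply: continuous_Rintegral_comp; first exact: continuous_cos.
  by move=> x; rewrite ler_norml cos_geN1 cos_le1.
have sin1 (x : R) : `|sin x| <= 1 by rewrite ler_norml sin_geN1 sin_le1.
have cS : continuous S.
  by apply: continuous_Rintegral_comp => //; exact: continuous_sin.
(* Dividing by the Gaussian characteristic function amounts to multiplying by [E l] and by the
   conjugate of [cis (m l)]; the three conditions are read off the resulting real and imaginary
   parts. *)
have {}phiE : phi = fun l =>
    (((C l * cos (m * l) + S l * sin (m * l)) * E l) +i*
     ((S l * cos (m * l) - C l * sin (m * l)) * E l))%C.
  apply/funext => l; rewrite phiE charfunE -/(C l) -/(S l).
  apply: (mulIf (gaussian_charfun_neq0 m s l)).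
  rewrite divfK ?gaussian_charfun_neq0// gaussian_charfunE /cis.
  have H := cos2Dsin2 (m * l); simpc.
  have EE : E l * expR (- (s ^+ 2 * l ^+ 2 / 2)) = 1 by rewrite expRxMexpNx_1.
  congr (_ +i* _)%C.
    transitivity (C l * (cos (m * l) ^+ 2 + sin (m * l) ^+ 2) *
      (E l * expR (- (s ^+ 2 * l ^+ 2 / 2)))); last by ring.
    by rewrite H EE !mulr1.
  transitivity (S l * (cos (m * l) ^+ 2 + sin (m * l) ^+ 2) *
    (E l * expR (- (s ^+ 2 * l ^+ 2 / 2)))); last by ring.
  by rewrite H EE !mulr1.
have cml (h : R -> R) : continuous h -> continuous (fun l => h (m * l)).
  move=> ch l.
  apply: (@continuous_comp _ _ _ (fun l => m * l) h); last exact: ch.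
  by apply: (@cvgM R _ _ _ (cst m) id); [exact: cvg_cst|exact: cvg_id].
have cE : continuous E.
  move=> l; have cl : {for l, continuous (fun l : R => s ^+ 2 * l ^+ 2 / 2)}.
    apply: cvgM; last exact: cvg_cst.
    by apply: cvgM; [exact: cvg_cst|exact: sqr_continuous].
  exact: (continuous_comp cl (@continuous_expR R _)).
have cM (f g : R -> R) : continuous f -> continuous g ->
    continuous (fun l => f l * g l).
  by move=> cf cg l; apply: cvgM; [exact: cf|exact: cg].
have cc := cml _ (@continuous_cos R); have cs := cml _ (@continuous_sin R).
split.
- rewrite phiE; apply: continuous_complex => /=; apply: (cM _ _ _ cE) => l.
    by apply: (@cvgD _ R^o); [exact: (cM _ _ cC cc)|exact: (cM _ _ cS cs)].
  by apply: (@cvgB _ R^o); [exact: (cM _ _ cS cc)|exact: (cM _ _ cC cs)].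
- have C0 : C 0 = 1.
    rewrite /C; under eq_Rintegral do rewrite mul0r cos0.
    rewrite Rintegral_cst// mul1r; exact: (congr1 fine (probability_setT P)).
  have S0 : S 0 = 0.
    rewrite /S; under eq_Rintegral do rewrite mul0r sin0.
    by rewrite Rintegral_cst// mul0r.
  rewrite phiE C0 S0 /E expr0n/= !(mulr0, mul0r) cos0 sin0 expR0.
  by rewrite !(mulr0, mul0r, mulr1, mul1r) addr0 subr0.
- move=> l; rewrite phiE /=.
  have -> : C (- l) = C l by apply: eq_Rintegral => w _; rewrite mulNr cosN.
  have -> : S (- l) = - S l.
    have iS := @integrable_comp_RV _ _ _ X _ l (@continuous_sin R) sin1.
    rewrite -[RHS]mulN1r /S -RintegralZl//; apply: eq_Rintegral => w _.
    by rewrite mulNr sinN mulN1r.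
  have -> : E (- l) = E l by rewrite /E sqrrN.
  rewrite mulrN cosN sinN; congr (_ +i* _)%C; ring.
Qed.

End characteristic_functions.

(** * Signed mixtures of normal densities *)

Section normal_mixture.
Context {R : realType}.
Local Notation mu := lebesgue_measure.
Implicit Types q : seq (R * R).

Definition normal_mixture q (s x : R) : R :=
  \sum_(p <- q) p.1 * normal_pdf p.2 s x.

Section bounded_test_function.
Variables (s : R) (h : R -> R) (K : R).
Hypothesis mh : measurable_fun setT h.
Hypothesis hK : forall x, `|h x| <= K.

Let ih (c : R) (p : R * R) :
  mu.-integrable setT (EFin \o (fun x => c * (h x * normal_pdf p.2 s x))).
Proof.
have := integrableZl measurableT c
  (@bounded_mul_normal_pdf_integrable _ p.2 s h K mh hK).
exact: eq_integrable.
Qed.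

Lemma integrable_normal_mixture q :
  mu.-integrable setT (EFin \o (fun x => h x * normal_mixture q s x)).
Proof.
elim: q => [|p q IH].
  apply: eq_integrable (integrable0 mu setT) => // x _.
  by rewrite /= /normal_mixture big_nil mulr0.
apply: eq_integrable (integrableD measurableT (ih p.1 p) IH) => // x _.
by rewrite /= /normal_mixture big_cons mulrDr EFinD mulrCA.
Qed.

Lemma Rintegral_normal_mixture q :
  \int[mu]_x (h x * normal_mixture q s x) =
  \sum_(p <- q) p.1 * \int[mu]_x (h x * normal_pdf p.2 s x).
Proof.
elim: q => [|p q IH].
  rewrite big_nil /normal_mixture.
  under eq_Rintegral do rewrite big_nil mulr0.
  by rewrite Rintegral_cst// mul0r.
rewrite big_cons -IH -RintegralZl//; last first.
  exact: bounded_mul_normal_pdf_integrable hK.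
rewrite -RintegralD//; last exact: integrable_normal_mixture.
by apply: eq_Rintegral => x _; rewrite /normal_mixture big_cons mulrDr mulrCA.
Qed.

End bounded_test_function.

(** Take the identity variable under the law with density [normal_mixture q s]. Its components share
    the variance [s^2], so the centered Gaussian factor divides out and leaves the exponential
    sum. *)
Lemma normal_mixture_setS0 q (s : R) : 0 < s ->
  (forall x, 0 <= normal_mixture q s x) -> \sum_(p <- q) p.1 = 1 ->
  setS0 R (expsum (complexify q)).
Proof.
move=> s0 q0 q1.
have one1 (x : R) : `|(cst 1 x : R)| <= 1 by rewrite normr1.
have mone : measurable_fun setT (cst 1 : R -> R) by exact: measurable_cst.
have iq : mu.-integrable setT (EFin \o normal_mixture q s).
  apply: eq_integrable (integrable_normal_mixture s mone one1 q) => // x _.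
  by rewrite /= mul1r.
have Iq : \int[mu]_x normal_mixture q s x = 1.
  transitivity (\int[mu]_x (cst 1 x * normal_mixture q s x)).
    by apply: eq_Rintegral => x _; rewrite /= mul1r.
  rewrite (Rintegral_normal_mixture s mone one1) -[RHS]q1.
  apply: eq_bigr => p _.
  rewrite -[RHS]mulr1; congr (_ * _).
  transitivity (\int[mu]_x normal_pdf p.2 s x).
    by apply: eq_Rintegral => x _; rewrite /= mul1r.
  by rewrite /Rintegral integral_normal_pdf.
have [P EP] := density_probability q0 iq Iq.
have mX : measurable_fun setT (idfun : measurableTypeR R -> R).
  exact: measurable_id.
pose X : {RV P >-> R} :=
  HB.pack (idfun : measurableTypeR R -> R) (isMeasurableFun.Build _ _ _ _ _ mX).
exists _, _, P, X, 0, s; split => // l.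
apply: (mulIf (gaussian_charfun_neq0 0 s l)).
rewrite divfK ?gaussian_charfun_neq0//.
have sin1 (x : R) : `|sin (l * x)| <= 1 by rewrite ler_norml sin_geN1 sin_le1.
have cos1 (x : R) : `|cos (l * x)| <= 1 by rewrite ler_norml cos_geN1 cos_le1.
have msin : measurable_fun setT (fun x : R => sin (l * x)).
  apply: measurableT_comp; last exact: measurable_funM.
  by apply: continuous_measurable_fun; exact: continuous_sin.
have mcos : measurable_fun setT (fun x : R => cos (l * x)).
  apply: measurableT_comp; last exact: measurable_funM.
  by apply: continuous_measurable_fun; exact: continuous_cos.
rewrite charfunE gaussian_charfunE mul0r cis0 mulr1.
rewrite [X in (X +i* _)%C](EP _ _ mcos cos1).
rewrite [X in (_ +i* X)%C](EP _ _ msin sin1).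
rewrite (Rintegral_normal_mixture s mcos cos1).
rewrite (Rintegral_normal_mixture s msin sin1).
under eq_bigr do rewrite normal_pdf_cos// mulrA.
under [X in (_ +i* X)%C]eq_bigr do rewrite normal_pdf_sin// mulrA.
rewrite -!big_distrl/= expsum_complexify.
set E := expR _.
have -> : \sum_(p <- q) p.1%:C%C * cis (l * p.2) =
  ((\sum_(p <- q) p.1 * cos (l * p.2)) +i*
   (\sum_(p <- q) p.1 * sin (l * p.2)))%C.
  elim: (q) => [|p q' IH]; first by rewrite !big_nil.
  by rewrite !big_cons IH /cis; simpc.
by simpc.
Qed.

(** Completing the square: [y^2 - (x - y)^2 = 2 x y - x^2], divided by [2 s^2]. *)
Lemma normal_pdf_shift (y s x : R) : 0 < s ->
  expR (y ^+ 2 / (2 * s ^+ 2)) * normal_pdf y s x =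
  normal_pdf 0 s x * expR (x / s ^+ 2 * y).
Proof.
move=> s0; have s_neq0 : s != 0 by rewrite gt_eqF.
rewrite !normal_pdfE// /normal_fun mulrCA -[RHS]mulrA -!expRD.
congr (_ * expR _).
by rewrite subr0; field.
Qed.

(** With [h = 1 / (2 s^2)] the factors are [exp (y_j^2 / (2 s^2))]; large [s] becomes [h] near
    [0]. *)
Definition reweight (h : R) q : seq (R * R) :=
  [seq (expR (h * p.2 ^+ 2) * p.1, p.2) | p <- q].

Lemma normal_mixture_reweight_ge0 q (s x : R) : 0 < s ->
  (forall t, 0 <= rexpsum q t) ->
  0 <= normal_mixture (reweight (2 * s ^+ 2)^-1 q) s x.
Proof.
move=> s0 q0; suff -> : normal_mixture (reweight (2 * s ^+ 2)^-1 q) s x =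
    normal_pdf 0 s x * rexpsum q (x / s ^+ 2).
  by rewrite mulr_ge0 ?normal_pdf_ge0.
rewrite /normal_mixture /reweight big_map /rexpsum big_distrr/=.
apply: eq_bigr => p _.
by rewrite mulrAC mulrC (mulrC _^-1) normal_pdf_shift// mulrCA.
Qed.

(** Uniform in [l] over the whole line: the frequencies are unchanged and [cis] has modulus [1], so
    only the finitely many coefficients matter, and each converges. *)
Lemma expsum_reweight_cvg q (e : R) : 0 < e ->
  \forall h \near 0^'+, forall l,
    normc (expsum (complexify (reweight h q)) l - expsum (complexify q) l) <= e.
Proof.
elim: q e => [|p q IH] e e0.
  apply: nearW => h l; rewrite !expsum_complexify !big_nil subrr normc0.
  exact: ltW.
have e20 : 0 < e / 2 by rewrite divr_gt0.
have : (fun h => expR (h * p.2 ^+ 2) * p.1 - p.1) h @[h --> (0 : R)^'+] -->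
    (0 : R).
  rewrite -[X in _ --> X](subrr p.1).
  apply: (@cvgB _ R^o); last exact: cvg_cst.
  rewrite -[X in _ --> X]mul1r; apply: cvgM; last exact: cvg_cst.
  apply: cvg_at_right_filter.
  have ch : {for (0 : R), continuous (fun h : R => h * p.2 ^+ 2)}.
    by apply: cvgM; [exact: cvg_id|exact: cvg_cst].
  have -> : 1 = expR (0 * p.2 ^+ 2) :> R by rewrite mul0r expR0.
  exact: (continuous_comp ch (@continuous_expR R _)).
move=> /cvgrPdist_le/(_ _ e20) H.
near=> h => l.
rewrite !expsum_complexify /reweight big_map !big_cons/= opprD addrACA.
rewrite -mulrBl -rmorphB (le_trans (normcD _ _))// (splitr e) lerD//.
  rewrite normcM normc_cis mulr1 normc_real -normrN -sub0r.
  by near: h.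
have : normc (expsum (complexify (reweight h q)) l -
    expsum (complexify q) l) <= e / 2.
  by move: l; near: h; exact: IH.
by rewrite !expsum_complexify /reweight big_map.
Unshelve. all: by end_near. Qed.

Lemma expsum0 q : expsum (complexify q) 0 = (\sum_(p <- q) p.1)%:C%C.
Proof.
rewrite expsum_complexify rmorph_sum; apply: eq_bigr => p _.
by rewrite mul0r cis0 mulr1.
Qed.

(** A sum [q] close to [phi] is reweighted with a small [h] and divided by its total mass [D], which
    is close to [1] because it is the value at [0] and [phi 0 = 1]. *)
Lemma setS0_approx (phi : R -> R[i]^o) (N e : R) :
  setS R phi -> 0 < N -> 0 < e ->
  exists2 g, setS0 R g & forall l, `|l| <= N -> normc (g l - phi l : R[i]) <= e.
Proof.
move=> [/[dup]/continuous_Re cRe /continuous_Im cIm phi0 hphi] N0 e0.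
have [M M0 phiM] := complex_continuous_bounded N cRe cIm.
(* Chosen so that [2 * d * (1 + M) = e * (1 - 2 * d)]. *)
pose d := e / (2 * (1 + M + e)).
have D0 : 0 < 2 * (1 + M + e) by rewrite mulr_gt0// ltr_wpDl// addr_ge0.
have d0 : 0 < d by exact: divr_gt0.
have dE : 2 * d * (1 + M + e) = e.
  by rewrite /d; field; rewrite !gt_eqF// ltr_wpDl// addr_ge0.
have [q q0 qphi] := nonnegative_expsum_approx cRe cIm phi0 hphi N0 d0.
near (0 : R)^'+ => h.
have h0 : 0 < h by near: h; exact: nbhs_right_gt.
have wq : forall l,
    normc (expsum (complexify (reweight h q)) l - expsum (complexify q) l) <= d.
  by near: h; exact: expsum_reweight_cvg.
pose w := reweight h q.
have wphi l : `|l| <= N ->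
    normc (expsum (complexify w) l - phi l : R[i]) <= 2 * d.
  move=> lN; rewrite -(subrKA (expsum (complexify q) l)).
  rewrite (le_trans (normcD _ _))// mulr_natl mulr2n lerD//; exact: qphi.
pose D := \sum_(p <- w) p.1.
have D1 : `|D - 1| <= 2 * d.
  have := wphi 0; rewrite normr0 expsum0 phi0 => /(_ (ltW N0)).
  by rewrite -normc_real rmorphB rmorph1.
pose g := [seq (p.1 / D, p.2) | p <- w].
have d1 : 2 * d < 1.
  by rewrite -(ltr_pM2r (_ : 0 < 1 + M + e)) ?ltr_wpDl ?addr_ge0// dE; lra.
have Dpos : 0 < D by move: D1; rewrite ler_norml => /andP[]; lra.
have gE l : expsum (complexify g) l = expsum (complexify w) l / D%:C%C.
  rewrite !expsum_complexify big_map mulr_suml; apply: eq_bigr => p _.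
  by rewrite rmorphM fmorphV/= mulrAC.
exists (expsum (complexify g)).
  pose s := Num.sqrt (2 * h)^-1.
  have s0 : 0 < s by rewrite sqrtr_gt0 invr_gt0 mulr_gt0.
  have hE : h = (2 * s ^+ 2)^-1.
    by rewrite sqr_sqrtr ?invr_ge0 ?mulr_ge0 ?(ltW h0)//; field; rewrite gt_eqF.
  apply: (@normal_mixture_setS0 _ s) => //.
    move=> x; have -> : normal_mixture g s x = normal_mixture w s x / D.
      rewrite /normal_mixture big_map mulr_suml; apply: eq_bigr => p _.
      by rewrite /= mulrAC.
    rewrite divr_ge0 ?(ltW Dpos)// /w hE.
    exact: normal_mixture_reweight_ge0.
  by rewrite /g big_map/= -mulr_suml divff// gt_eqF.
move=> l lN; rewrite gE.
have DC : (D%:C%C : R[i]) != 0.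
  by apply/eqP => /complexI; apply/eqP; rewrite gt_eqF.
have -> : expsum (complexify w) l / D%:C%C - phi l =
  ((expsum (complexify w) l - phi l) - phi l * (D - 1)%:C%C) * (D^-1)%:C%C.
  by rewrite rmorphB rmorph1 fmorphV; field.
rewrite normcM normc_real gtr0_norm ?invr_gt0// ler_pdivrMr//.
rewrite (le_trans (normcB _ _))// normcM normc_real.
have A := wphi l lN.
have B : normc (phi l) * `|D - 1| <= M * (2 * d).
  by rewrite ler_pM// ?normc_ge0// phiM.
have C : 1 - 2 * d <= D by move: D1; rewrite ler_norml => /andP[]; lra.
have C' : e * (1 - 2 * d) <= e * D by rewrite ler_pM2l.
(* The two errors add up to at most [2 d (1 + M) = e (1 - 2 d)], and [1 - 2 d <= D]. *)
apply: le_trans C'; apply: (le_trans (lerD A B)).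
by move: dE; clear; lra.
Unshelve. all: by end_near. Qed.

End normal_mixture.

(** * Density for uniform convergence on compact sets *)

Theorem theorem1p2 (R : realType) :
  dense_in (setS0 R : set {family compact, R -> (R[i]^o)%R}) (setS R).
Proof.
split; first exact: setS0_sub_setS.
move=> phi Sphi.
(* The windows [[- n - 1, n + 1]] exhaust the line while the errors [1 / (n + 1)] vanish, so the
   chosen functions converge to [phi] uniformly on every compact set. The successor keeps both
   quantities positive. *)
have approx (n : nat) : exists g : R -> R[i]^o, setS0 R g /\
    forall l, `|l| <= n.+1%:R -> normc (g l - phi l : R[i]) <= n.+1%:R^-1.
  have [||g g0 gphi] := @setS0_approx R phi n.+1%:R n.+1%:R^-1 Sphi.
  - by rewrite ltr0n.
  - by rewrite invr_gt0 ltr0n.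
  - by exists g.
have /choice[g gP] := approx.
have gphi : {family compact, g @ \oo --> phi}.
  apply/fam_cvgP => K cK B /uniform_nbhs[E [entE EB]].
  have [M [_ KM]] := compact_bounded cK.
  move: entE; rewrite -entourage_ballE => -[e /= e0 eE].
  have eRe : e = (complex.Re e)%:C%C by rewrite RRe_real// gtr0_real.
  have Re0 : 0 < complex.Re e by move: e0; rewrite ltcE => /andP[].
  near=> n; apply: EB => /= l Kl; apply: eE => /=.
  (* Large [n] puts [K] inside the window and the error below the radius [e]. *)
  have nM : M + 1 <= n%:R by near: n; exact: nbhs_infty_ger.
  have ne : (complex.Re e)^-1 + 1 <= n%:R by near: n; exact: nbhs_infty_ger.
  rewrite eRe -[X in X _ _ _]ball_normE /= normr_complexE ltcR -normcN opprB.
  have nn : n%:R < n.+1%:R :> R by rewrite ltr_nat.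
  apply: (@le_lt_trans _ _ n.+1%:R^-1).
    apply: (gP n).2; apply: (KM n.+1%:R) => //.
    by rewrite (lt_trans _ nn)// (lt_le_trans _ nM)// ltrDl.
  rewrite -[ltRHS]invrK ltf_pV2 ?posrE ?invr_gt0// ?ltr0n//.
  by rewrite (lt_trans _ nn)// (lt_le_trans _ ne)// ltrDl.
move=> B nB.
have [n _ nE] := gphi _ nB.
by exists (g n); split; [exact: (gP n).1|exact: (nE n (leqnn n))].
Unshelve. all: by end_near. Qed.
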